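(* Let $n\ge 2$ and let $\Gamma_{n-1}\subset\Gamma_n$ be an inclusion of Coxeter graphs of spherical type with vertex sets $\{x_1,\dots,x_{n-1}\}$ and $\{x_1,\dots,x_n\}$ respectively. Let $R_n=\Delta(\Gamma_n,\Gamma_{n-1})$ be the relative Garside element, let $\sigma_n$ be the bijection of $\{1,\dots,n\}$ with $x_i\Delta(\Gamma_n)=\Delta(\Gamma_n)x_{\sigma_n(i)}$, let $m=\sigma_n(n)$, and let $\sigma:\{1,\dots,n-1\}\to\{1,\dots,n\}\setminus\{m\}$ be the bijection with $x_iR_n=R_nx_{\sigma(i)}$. Suppose $U_n\in\mathcal{M}(\Gamma_n)$ satisfies: (a) $x_n\mid_L U_n$; (b) there are $k\in\{1,\dots,n\}$ and a bijection $\tau:\{1,\dots,n-1\}\to\{1,\dots,n\}\setminus\{k\}$ such that $x_iU_n=U_nx_{\tau(i)}$ for all $i\in\{1,\dots,n-1\}$; (c) the length of $U_n$ is $l(\Gamma_n)-l(\Gamma_{n-1})$, where $l(\Gamma)$ denotes the length of the Garside element $\Delta(\Gamma)$. Then $U_n=R_n$ (and also $k=m$ and $\tau=\sigma$).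
   Context: A Coxeter matrix over a set $S$ is $M=(m_{st})_{s,t\in S}$ with $m_{ss}=1$ and $m_{st}=m_{ts}\in\{2,3,4,\dots,\infty\}$ for $s\ne t$; its Coxeter graph $\Gamma$ has vertex set $S$, an edge between $s,t$ when $m_{st}\ge3$, labelled by $m_{st}$ when $m_{st}\ge4$. The Artin monoid $\mathcal{M}(\Gamma)$ is the monoid generated by $S$ with relations $\underbrace{sts\cdots}_{m_{st}}=\underbrace{tst\cdots}_{m_{st}}$ for all $s\ne t$ with $m_{st}\neq\infty$. The relations are homogeneous, so every element has a well-defined length (number of generators in any word representing it). $\Gamma$ is of spherical type if the Coxeter group (obtained by adding the relations $s^2=1$) is finite. An inclusion $\Gamma_{n-1}\subset\Gamma_n$ means that $\Gamma_{n-1}$ is the full labelled subgraph of $\Gamma_n$ on the vertices $x_1,\dots,x_{n-1}$ (so $\Gamma_n$ has one new vertex $x_n$); $\mathcal{M}(\Gamma_{n-1})$ is regarded as the submonoid of $\mathcal{M}(\Gamma_n)$ generated by $x_1,\dots,x_{n-1}$. Left divisibility in a monoid: $\alpha\mid_L\beta$ means $\beta=\alpha\rho$ for some $\rho$. For $\Gamma$ of spherical type, the Garside element $\Delta(\Gamma)\in\mathcal{M}(\Gamma)$ is the unique element such that $s\mid_L\Delta(\Gamma)$ for every generator $s$, and whenever $s\mid_L\omega$ for all generators $s$ then $\Delta(\Gamma)\mid_L\omega$. Its length $l(\Gamma)$ equals the number of reflections of the associated Coxeter group; for connected $\Gamma$ it is: $A_n$: $\binom{n+1}{2}$; $B_n$: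 $n^2$; $D_n$: $n^2-n$; $E_6$: 36; $E_7$: 63; $E_8$: 120; $F_4$: 24; $G_2$: 6; $H_3$: 15; $H_4$: 60; $I_2(p)$: $p$. One has $\Delta(\Gamma_{n-1})\mid_L\Delta(\Gamma_n)$, and the relative Garside element $R_n=\Delta(\Gamma_n,\Gamma_{n-1})$ is the (unique, by cancellativity) element with $\Delta(\Gamma_n)=\Delta(\Gamma_{n-1})\,R_n$. It is a known fact that conjugation by the Garside element permutes the generators, which gives the bijection $\sigma_n$; the bijection $\sigma$ exists and is $\sigma=\sigma_n\circ\sigma_{n-1}^{-1}$, where $\sigma_{n-1}$ is the analogous bijection of $\{1,\dots,n-1\}$ for $\Delta(\Gamma_{n-1})$. *)

(* Defs.v *)
From HB Require Import structures.
From mathcomp Require Import all_boot.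
From mathcomp Require Import boolp classical_sets functions cardinality.

Set Implicit Arguments.
Unset Strict Implicit.
Unset Printing Implicit Defensive.

Local Open Scope group_scope.
Local Open Scope quotient_scope.

Section Congruence.
Variables (S : Type) (R : seq S -> seq S -> Prop).

Inductive word_cong : seq S -> seq S -> Prop :=
| wc_rel u v a b : R u v -> word_cong (a ++ u ++ b) (a ++ v ++ b)
| wc_refl u : word_cong u u
| wc_sym u v : word_cong u v -> word_cong v u
| wc_trans u v w : word_cong u v -> word_cong v w -> word_cong u w.

Lemma word_cong_cat u u' v v' :
  word_cong u u' -> word_cong v v' -> word_cong (u ++ v) (u' ++ v').
Proof.
move=> uu' vv'; apply: (@wc_trans _ (u' ++ v)).
  elim: uu' => {u u'} [u u' a b r|u|u u' _ /wc_sym //|u u' w _ h _].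
  - by rewrite -!catA; exact: wc_rel.
  - exact: wc_refl.
  - exact: wc_trans h.
elim: vv' => {v v'} [v v' a b r|v|v v' _ /wc_sym //|v v' w _ h _].
- by rewrite 2!(catA u'); exact: wc_rel.
- exact: wc_refl.
- exact: wc_trans h.
Qed.

End Congruence.

Section Presentation.
Variables (S : choiceType) (R : seq S -> seq S -> Prop).

(* The congruence need not be decidable; [asbool] makes it boolean, as
   [{eq_quot _}] requires. *)
Definition word_congb : rel (seq S) := fun u v => `[< word_cong R u v >].

Fact word_congb_refl : reflexive word_congb.
Proof. by move=> u; apply/asboolP; exact: wc_refl. Qed.
Fact word_congb_sym : symmetric word_congb.
Proof. by move=> u v; apply/asboolP/asboolP => /wc_sym. Qed.
Fact word_congb_trans : transitive word_congb.
Proof.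
by move=> v u w /asboolP uv /asboolP vw; apply/asboolP; exact: wc_trans vw.
Qed.

Canonical word_congb_equiv :=
  EquivRel word_congb word_congb_refl word_congb_sym word_congb_trans.

Definition presented := {eq_quot word_congb_equiv}.
HB.instance Definition _ := EqQuotient.on presented.
HB.instance Definition _ := Choice.on presented.

Lemma presented_eqP (u v : seq S) :
  \pi_presented u = \pi_presented v <-> word_cong R u v.
Proof.
split; first by move=> /eqmodP /asboolP.
by move=> uv; apply/eqmodP/asboolP.
Qed.

Lemma word_cong_repr (u : seq S) : word_cong R (repr (\pi_presented u)) u.
Proof. by apply/presented_eqP; rewrite reprK. Qed.

Definition presented_mul (x y : presented) : presented :=
  \pi_presented (repr x ++ repr y).
Definition presented_one : presented := \pi_presented [::].

Lemma presented_mulE u v :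
  presented_mul (\pi_presented u) (\pi_presented v) = \pi_presented (u ++ v).
Proof. by apply/presented_eqP/word_cong_cat; exact: word_cong_repr. Qed.

Fact presented_mulA : associative presented_mul.
Proof.
move=> x y z; rewrite -[x]reprK -[y]reprK -[z]reprK.
rewrite (presented_mulE (repr y)) (presented_mulE (repr x)).
by rewrite (presented_mulE (repr x)) presented_mulE catA.
Qed.
Fact presented_mul1 : left_id presented_one presented_mul.
Proof. by move=> x; rewrite -[x]reprK presented_mulE. Qed.
Fact presented_mulr1 : right_id presented_one presented_mul.
Proof. by move=> x; rewrite -[x]reprK presented_mulE cats0. Qed.

HB.instance Definition _ := isMonoid.Build presented
  presented_mulA presented_mul1 presented_mulr1.

Definition gen (s : S) : presented := \pi_presented [:: s].

Lemma pi_catE u v :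
  \pi_presented (u ++ v) = \pi_presented u * \pi_presented v.
Proof. by rewrite -presented_mulE. Qed.

End Presentation.

(* [None] stands for the entry infinity. *)
Record coxeter_matrix (S : Type) := CoxeterMatrix {
  cox_entry :> S -> S -> option nat;
  cox_diag : forall s, cox_entry s s = Some 1%N;
  cox_sym : forall s t, cox_entry s t = cox_entry t s;
  cox_ge2 : forall s t k, s <> t -> cox_entry s t = Some k -> (2 <= k)%N }.

(* s t s t ... with k letters *)
Fixpoint alt (S : Type) (k : nat) (s t : S) : seq S :=
  if k is k'.+1 then s :: alt k' t s else [::].

Lemma size_alt (S : Type) k (s t : S) : size (alt k s t) = k.
Proof. by elim: k s t => //= k IH s t; rewrite IH. Qed.

Lemma map_alt (S T : Type) (f : S -> T) k s t :
  map f (alt k s t) = alt k (f s) (f t).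
Proof. by elim: k s t => //= k IH s t; rewrite IH. Qed.

Inductive braid_rel (S : Type) (M : coxeter_matrix S) :
  seq S -> seq S -> Prop :=
| BraidRel s t k : s <> t -> M s t = Some k ->
    braid_rel M (alt k s t) (alt k t s).

Inductive coxeter_rel (S : Type) (M : coxeter_matrix S) :
  seq S -> seq S -> Prop :=
| CoxBraid u v : braid_rel M u v -> coxeter_rel M u v
| CoxSquare s : coxeter_rel M [:: s; s] [::].

Definition artin_monoid (S : choiceType) (M : coxeter_matrix S) :=
  presented (braid_rel M).
HB.instance Definition _ (S : choiceType) (M : coxeter_matrix S) :=
  EqQuotient.on (artin_monoid M).
HB.instance Definition _ (S : choiceType) (M : coxeter_matrix S) :=
  Monoid.on (artin_monoid M).

Definition agen (S : choiceType) (M : coxeter_matrix S) (s : S) :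
  artin_monoid M := gen (braid_rel M) s.

(* As every generator is an involution, the monoid with this presentation is
   the Coxeter group; inversion reverses words. *)
Definition coxeter_group (S : choiceType) (M : coxeter_matrix S) :=
  presented (coxeter_rel M).
HB.instance Definition _ (S : choiceType) (M : coxeter_matrix S) :=
  EqQuotient.on (coxeter_group M).
HB.instance Definition _ (S : choiceType) (M : coxeter_matrix S) :=
  Monoid.on (coxeter_group M).

Section CoxeterGroup.
Variables (S : choiceType) (M : coxeter_matrix S).

Definition coxeter_inv (x : coxeter_group M) : coxeter_group M :=
  \pi_(coxeter_group M) (rev (repr x)).

Lemma word_cong_revl (u : seq S) : word_cong (coxeter_rel M) (rev u ++ u) [::].
Proof.
elim: u => [|s u IH]; first exact: wc_refl.
apply: wc_trans IH; rewrite rev_cons cat_rcons.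
exact: (wc_rel (rev u) u (CoxSquare M s)).
Qed.

Fact coxeter_mulVg : left_inverse 1 coxeter_inv (@mul (coxeter_group M)).
Proof.
move=> x; rewrite /coxeter_inv -{2}[x]reprK -pi_catE.
by apply/presented_eqP; exact: word_cong_revl.
Qed.

Fact coxeter_mulgV : right_inverse 1 coxeter_inv (@mul (coxeter_group M)).
Proof.
move=> x; rewrite /coxeter_inv -{1}[x]reprK -pi_catE.
by apply/presented_eqP; rewrite -{1}[repr x]revK; exact: word_cong_revl.
Qed.

HB.instance Definition _ := hasInv.Build (coxeter_group M) coxeter_inv.
HB.instance Definition _ :=
  Monoid_isGroup.Build (coxeter_group M) coxeter_mulVg coxeter_mulgV.
End CoxeterGroup.

Definition spherical (S : choiceType) (M : coxeter_matrix S) : Prop :=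
  finite_set [set: coxeter_group M]%classic.

Definition artin_length (S : choiceType) (M : coxeter_matrix S)
  (x : artin_monoid M) : nat := size (repr x).

Lemma braid_cong_size (S : Type) (M : coxeter_matrix S) (u v : seq S) :
  word_cong (braid_rel M) u v -> size u = size v.
Proof.
elim=> // {u v} [u v a b [s t k _ _]|u v w _ -> _ -> //].
by rewrite !size_cat !size_alt.
Qed.

Lemma artin_lengthE (S : choiceType) (M : coxeter_matrix S) (w : seq S) :
  artin_length (\pi_(artin_monoid M) w) = size w.
Proof. exact: braid_cong_size (word_cong_repr _ w). Qed.

Definition ldvd (G : monoidType) (a b : G) : Prop := exists r, b = a * r.

Definition is_garside (S : choiceType) (M : coxeter_matrix S)
    (D : artin_monoid M) : Prop :=
  (forall s, ldvd (agen M s) D) /\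
  (forall w, (forall s, ldvd (agen M s) w) -> ldvd D w).

(* Absence of an edge and the label 3 are both recorded by the entries of the
   matrix, so being a full labelled subgraph is equality of all entries. *)
Definition full_subgraph (S T : Type) (f : S -> T)
    (N : coxeter_matrix S) (M : coxeter_matrix T) : Prop :=
  injective f /\ forall s t, N s t = M (f s) (f t).

Section Inclusion.
Variables (S T : choiceType) (f : S -> T).
Variables (N : coxeter_matrix S) (M : coxeter_matrix T).
Hypothesis sub : full_subgraph f N M.

Definition artin_incl (_ : full_subgraph f N M) (x : artin_monoid N) :
  artin_monoid M := \pi_(artin_monoid M) (map f (repr x)).

Lemma braid_cong_map (u v : seq S) :
  word_cong (braid_rel N) u v -> word_cong (braid_rel M) (map f u) (map f v).
Proof.
have [finj fM] := sub.
elim=> {u v} [u v a b [s t k st Nst]|u|u v _ /wc_sym//|u v w _ uv _].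
- rewrite !map_cat !map_alt; apply: wc_rel.
  by apply: BraidRel; [move=> /finj | rewrite -fM].
- exact: wc_refl.
- exact: wc_trans.
Qed.

Lemma artin_inclE (w : seq S) :
  artin_incl sub (\pi_(artin_monoid N) w) = \pi_(artin_monoid M) (map f w).
Proof.
by apply/presented_eqP/braid_cong_map; exact: (word_cong_repr (braid_rel N)).
Qed.

Lemma artin_incl_gen s : artin_incl sub (agen N s) = agen M (f s).
Proof. exact: artin_inclE. Qed.

Fact artin_inclM : {morph artin_incl sub : x y / x * y}.
Proof.
move=> x y; rewrite -[x]reprK -[y]reprK -pi_catE !artin_inclE map_cat.
exact: pi_catE.
Qed.

Fact artin_incl1 : artin_incl sub 1 = 1.
Proof. exact: (artin_inclE [::]). Qed.

HB.instance Definition _ :=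
  isUMagmaMorphism.Build (artin_monoid N) (artin_monoid M) (artin_incl sub)
    (conj artin_incl1 artin_inclM).
End Inclusion.

(* The indices 1, ..., p+1 of the generators are the elements of ['I_p.+1];
   ['I_p] is included as the first p of them, the new one being [ord_max]. *)
Definition old_vertex (p : nat) : 'I_p -> 'I_p.+1 := widen_ord (leqnSn p).

(* Main.v *)
Require Import Defs.
From HB Require Import structures.
From mathcomp Require Import all_boot all_fingroup.
From mathcomp Require Import boolp classical_sets functions cardinality.
From mathcomp Require Import ssralg poly algC cyclotomic.
From mathcomp Require Import generic_quotient ring.

(** Write [D'] also for the image of that element in the monoid of [M]. The
idea is to show that [D' * U] is divisible by every generator. An old
generator divides [D']. The relations [x_i U = U x_(tau i)] push a word for
[D'] through [U], so that [D' * U] also starts with [U], hence with the new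
generator. So [D] divides [D' * U], and these elements have the same length:
[D' * U = D = D' * R]. It remains to cancel [D'].

Artin monoids are cancellative, but only cancellation inside the Garside
element is needed, and there it can be read off in the Coxeter group [W].
A word is reduced if no shorter word has the same value in [W].
- [matsumoto]: reduced words with the same value in [W] are equal already in
  the Artin monoid.
- [garside_reduced]: [D] is represented by reduced words. Indeed [W] is
  finite, so it has a reduced word that no letter can lengthen on the left; by
  the exchange condition and [matsumoto] its class in the monoid is divisible
  by every generator, hence by [D], and a factor of a reduced word is reduced.
Hence the words of [U] and [R], being suffixes of words of [D], are reduced;
they have the same value in [W], so [U = R]. The generators are distinct in
[W], so [U x_(tau i) = U x_(sigma i)] gives [tau = sigma], and [k] and
[sigma_n ord_max] are then the only index that this map misses.

The two ingredients of [matsumoto] are facts on a Coxeter group given by its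
presentation. The exchange condition ([parity_delete], [descent_parity]) comes
from the parity of the number of times that a word crosses the wall of a
reflection, which depends only on the value of the word. That the order of [st]
is not smaller than [M s t] ([cgen_mul_order]) comes from a linear
representation over the algebraic numbers. *)

Set Implicit Arguments.
Unset Strict Implicit.
Unset Printing Implicit Defensive.

Import GRing.Theory.
Local Open Scope group_scope.
Local Open Scope quotient_scope.

(** * Words in a Coxeter group *)

Section CoxeterWords.
Variables (S : choiceType) (M : coxeter_matrix S).

Definition cox_word (u : seq S) : coxeter_group M := \pi_(coxeter_group M) u.
Definition cox_gen (s : S) : coxeter_group M := cox_word [:: s].
Notation cgen := cox_gen.

Lemma cox_wordP u v :
  cox_word u = cox_word v <-> word_cong (coxeter_rel M) u v.
Proof. exact: presented_eqP. Qed.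

Lemma cox_word_cat u v : cox_word (u ++ v) = cox_word u * cox_word v.
Proof. exact: pi_catE. Qed.

Lemma cox_word_nil : cox_word [::] = 1.
Proof. by []. Qed.

Lemma cox_word_cons s u : cox_word (s :: u) = cgen s * cox_word u.
Proof. exact: (cox_word_cat [:: s]). Qed.

Lemma cgenK s : cgen s * cgen s = 1.
Proof.
rewrite -(cox_word_cat [:: s]) -cox_word_nil; apply/cox_wordP.
exact: (wc_rel [::] [::] (CoxSquare M s)).
Qed.

Lemma cgenV s : (cgen s)^-1 = cgen s.
Proof. exact: mulg1_eq (cgenK s). Qed.

Lemma cgenKl s x : cgen s * (cgen s * x) = x.
Proof. by rewrite mulgA cgenK mul1g. Qed.

Lemma cgenJ x s : x ^ cgen s = cgen s * (x * cgen s).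
Proof. by rewrite conjgE cgenV. Qed.

Lemma expg_shift (G : monoidType) (x y : G) k :
  x * (y * x) ^+ k = (x * y) ^+ k * x.
Proof.
elim: k => [|k IH]; first by rewrite mulg1 mul1g.
by rewrite expgSr mulgA IH expgSr !mulgA.
Qed.

Lemma alt_ratio k s t :
  cox_word (alt k s t) * (cox_word (alt k t s))^-1 = (cgen s * cgen t) ^+ k.
Proof.
elim: k s t => [|k IH] s t; first by rewrite mulgV.
rewrite /= !cox_word_cons invgM cgenV mulgA -(mulgA (cgen s)).
by rewrite IH expg_shift expgSr !mulgA.
Qed.

(** Turns a braid relation into a statement on the order of [st]. *)
Lemma alt_eq_expg k s t :
  cox_word (alt k s t) = cox_word (alt k t s) <-> (cgen s * cgen t) ^+ k = 1.
Proof.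
rewrite -alt_ratio; split=> [->|]; first exact: mulgV.
by move/mulg1_eq/invg_inj.
Qed.

(** * The order of a product of two generators *)

Local Open Scope ring_scope.

Definition unity_root (n : nat) : algC :=
  sval (C_prim_root_exists (ltn0Sn n.-1)).

Lemma unity_rootP n : (0 < n)%N -> n.-primitive_root (unity_root n).
Proof.
by move=> n0; rewrite -{1}(prednK n0) /unity_root; case: C_prim_root_exists.
Qed.

Variable N : nat.
Hypothesis N_gt0 : (0 < N)%N.

(** An infinite entry is replaced by an arbitrary [N]: as an infinite entry
imposes no relation, the representation below exists for every [N], and a large
[N] shows that [st] has no small order. *)
Definition edge_order s t : nat := odflt N (M s t).

Lemma edge_order_gt0 s t : (0 < edge_order s t)%N.
Proof.
rewrite /edge_order; have [->|/eqP st] := eqVneq s t; first by rewrite cox_diag.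
case Mst: (M s t) => [m|//].
exact: ltn_trans (cox_ge2 st Mst).
Qed.

(** A square root of a primitive root of unity of order [edge_order s t]. *)
Definition edge_root s t : algC := unity_root (edge_order s t).*2.

Lemma edge_rootP s t : (edge_order s t).*2.-primitive_root (edge_root s t).
Proof. by apply: unity_rootP; rewrite double_gt0 edge_order_gt0. Qed.

Lemma edge_root_sym s t : edge_root s t = edge_root t s.
Proof. by rewrite /edge_root /edge_order cox_sym. Qed.

Lemma edge_root_neq0 s t : edge_root s t != 0.
Proof.
by rewrite (prim_root_eq0 (edge_rootP s t)) -lt0n double_gt0 edge_order_gt0.
Qed.

Definition coef s t : algC := edge_root s t + (edge_root s t)^-1.

(** On the diagonal the entry 1 gives the root [-1]: this is the usual
normalisation of a generalized Cartan matrix. *)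
Lemma coef_diag s : coef s s = -2.
Proof.
have := edge_rootP s s; rewrite /coef /edge_order cox_diag /= => z2.
have zz : edge_root s s ^+ 2 = 1 by exact: (prim_expr_order z2).
have /negP z1 : edge_root s s != 1 by rewrite -(prim_order_dvd z2 1).
move/eqP: zz; rewrite sqrf_eq1 => /orP[/z1//|/eqP->].
by rewrite invrN1; ring.
Qed.

Lemma coef_sym s t : coef s t = coef t s.
Proof. by rewrite /coef edge_root_sym. Qed.

(** A variant of the dual of the geometric representation, with [coef s t] in
the place of twice the cosine of [pi / M s t]: [f] is a linear form on the
root space, known by its values on the simple roots. Working with forms makes
all functions on [S] available, without any choice of a basis. *)
Definition refl_act s (f : S -> algC) : S -> algC :=
  fun t => f t + coef s t * f s.

Definition word_act (u : seq S) (f : S -> algC) : S -> algC :=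
  foldr refl_act f u.

Lemma word_act_cat u v f : word_act (u ++ v) f = word_act u (word_act v f).
Proof. exact: foldr_cat. Qed.

Lemma refl_actK s f : refl_act s (refl_act s f) = f.
Proof. by apply/funext => t; rewrite /refl_act coef_diag; ring. Qed.

(** On the plane of the values at [s] and [t] the two reflections generate a
dihedral group; in the coordinates [eigen s t] and [eigen t s] they are
monomial, and alternating words can be computed in closed form. *)
Definition eigen s t (f : S -> algC) : algC := f s + edge_root s t * f t.

Lemma eigen_refl_actl s t f :
  eigen s t (refl_act s f) = edge_root s t * eigen t s f.
Proof.
rewrite /eigen /refl_act coef_diag /coef (edge_root_sym t s).
by field; exact: edge_root_neq0.
Qed.

Lemma eigen_refl_actr s t f :
  eigen t s (refl_act s f) = (edge_root s t)^-1 * eigen s t f.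
Proof.
rewrite /eigen /refl_act coef_diag /coef (edge_root_sym t s).
by field; exact: edge_root_neq0.
Qed.

Lemma eigen_alt k s t f :
  (eigen s t (word_act (alt k s t) f) =
     edge_root s t ^+ k * (if odd k then eigen t s f else eigen s t f)) *
  (eigen t s (word_act (alt k s t) f) =
     edge_root s t ^- k * (if odd k then eigen s t f else eigen t s f)).
Proof.
elim: k s t => [|k IH] s t; first by rewrite !expr0 invr1 !mul1r.
rewrite /= eigen_refl_actl eigen_refl_actr (IH t s).1 (IH t s).2.
rewrite (edge_root_sym t s).
by rewrite exprS invfM !mulrA; split; case: (odd k).
Qed.

Lemma edge_root_order s t j :
  (edge_root s t ^+ j.*2 == 1) = (edge_order s t %| j)%N.
Proof. by rewrite -(prim_order_dvd (edge_rootP s t)) -!muln2 dvdn_pmul2r. Qed.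

Lemma edge_root_sqr_neq1 s t m : s <> t -> M s t = Some m ->
  1 - edge_root s t ^+ 2 != 0.
Proof.
move=> st Mst; rewrite subr_eq0 eq_sym (edge_root_order s t 1) /edge_order.
by rewrite Mst dvdn1; have := cox_ge2 st Mst; case: m {Mst} => [|[|]].
Qed.

Lemma eigen_inj s t f g : 1 - edge_root s t ^+ 2 != 0 ->
  eigen s t f = eigen s t g -> eigen t s f = eigen t s g -> f s = g s.
Proof.
move=> z2 ef eg; apply: (mulfI z2).
have E h : (1 - edge_root s t ^+ 2) * h s
    = eigen s t h - edge_root s t * eigen t s h.
  by rewrite /eigen (edge_root_sym t s); ring.
by rewrite !E ef eg.
Qed.

(** The value of [f] at a vector fixed by both reflections. It involves the
value at [r] with the coefficient [4 - coef s t ^+ 2], the determinant of the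
plane of [s] and [t]; when this is not zero, the value at [r] after an
alternating word is known from those at [s] and [t]. *)
Definition transverse s t r (f : S -> algC) : algC :=
  (4 - coef s t ^+ 2) * f r + (2 * coef s r + coef s t * coef t r) * f s
    + (2 * coef t r + coef s t * coef s r) * f t.

Lemma transverse_alt k s t r f :
  (transverse s t r (word_act (alt k s t) f) = transverse s t r f) *
  (transverse s t r (word_act (alt k t s) f) = transverse s t r f).
Proof.
elim: k => [//|k [IH1 IH2]] /=; split; [rewrite -IH2|rewrite -IH1].
all: by rewrite /transverse /refl_act ?coef_diag ?(coef_sym t s); ring.
Qed.

(** Both sides agree in the coordinates of the plane because the [m]-th power of
[edge_root s t] is a sign, and elsewhere by [transverse_alt]. *)
Lemma word_act_braid s t m f : s <> t -> M s t = Some m ->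
  word_act (alt m s t) f = word_act (alt m t s) f.
Proof.
move=> st Mst; set z := edge_root s t.
have zm : z ^+ m = z ^- m.
  apply: (mulfI (expf_neq0 m (edge_root_neq0 s t))).
  rewrite mulfV ?expf_neq0 ?edge_root_neq0 // -exprD addnn; apply/eqP.
  by rewrite edge_root_order /edge_order Mst dvdnn.
have z2 := edge_root_sqr_neq1 st Mst.
have z2' : 1 - edge_root t s ^+ 2 != 0 by rewrite edge_root_sym.
have Est : eigen s t (word_act (alt m s t) f)
    = eigen s t (word_act (alt m t s) f).
  rewrite (eigen_alt m s t f).1 (eigen_alt m t s f).2.
  by rewrite (edge_root_sym t s) -/z -zm.
have Ets : eigen t s (word_act (alt m s t) f)
    = eigen t s (word_act (alt m t s) f).
  rewrite (eigen_alt m s t f).2 (eigen_alt m t s f).1.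
  by rewrite (edge_root_sym t s) -/z -zm.
have Es := eigen_inj z2 Est Ets.
have Et := eigen_inj z2' Ets Est.
apply/funext => r.
have := transverse_alt m s t r f => -[R1 R2].
have := etrans R1 (esym R2); rewrite /transverse Es Et.
move/addIr/addIr; apply: mulfI.
have -> : 4 - coef s t ^+ 2 = - ((1 - z ^+ 2) / z) ^+ 2.
  by rewrite /coef -/z; field; exact: edge_root_neq0.
by rewrite oppr_eq0 expf_neq0 // mulf_neq0 // invr_eq0 edge_root_neq0.
Qed.

Lemma word_act_cong u v :
  word_cong (coxeter_rel M) u v -> word_act u = word_act v.
Proof.
elim=> {u v} [u v a b r|//|u v _ ->//|u v w _ -> _ -> //].
apply/funext => f; rewrite !word_act_cat; congr (word_act a _).
case: r => [_ _ [s t m st Mst]|s]; first exact: word_act_braid.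
by rewrite /= refl_actK.
Qed.

(** Up to the exchange of the two coordinates, [alt j s t] multiplies one of
them by the [j]-th power of [edge_root s t] and [alt j t s] by its inverse, so
that this power is a sign. *)
Lemma edge_order_dvd s t j : s <> t ->
  ((cgen s * cgen t)%g ^+ j)%g = 1%g -> (edge_order s t %| j)%N.
Proof.
move=> /eqP st /alt_eq_expg/cox_wordP/word_act_cong E.
rewrite -edge_root_order; set z := edge_root s t.
have z0 : z != 0 by exact: edge_root_neq0.
(* Any form with two nonzero coordinates would do. *)
pose f r : algC := (r == t)%:R.
have [P Q] : eigen s t f = z /\ eigen t s f = 1.
  by rewrite /eigen /f eqxx (negPf st) mulr1 add0r mulr0 addr0.
have := congr1 (fun h => eigen s t (h f)) E.
rewrite (eigen_alt j s t f).1 (eigen_alt j t s f).2 P Q (edge_root_sym t s) -/z.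
move/mulIf => E'; rewrite -addnn exprD [X in X * _]E' ?mulVf ?expf_neq0 //.
by case: (odd j); rewrite ?oner_eq0.
Qed.
End CoxeterWords.

Section Order.
Variables (S : choiceType) (M : coxeter_matrix S).
Notation cgen := (cox_gen M).

Lemma cgen_mul_order s t j : s <> t -> (0 < j)%N ->
  (cgen s * cgen t) ^+ j = 1 -> exists2 m, M s t = Some m & (m <= j)%N.
Proof.
(* With [N := j.+1] an infinite entry would give [j.+1 <= j]. *)
move=> st j0 /(edge_order_dvd (N := j.+1) isT st)/(dvdn_leq j0).
by rewrite /edge_order; case: (M s t) => [m|]/=; [exists m | rewrite ltnn].
Qed.

Lemma cgen_inj : injective cgen.
Proof.
move=> s t st; apply: contrapT => nst.
have [|m Mst] := cgen_mul_order (j := 1) nst isT; first by rewrite st cgenK.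
by rewrite leqNgt (cox_ge2 nst Mst).
Qed.
End Order.

(** * The exchange condition *)

Lemma braid_cong_cox (S : choiceType) (M : coxeter_matrix S) u v :
  word_cong (braid_rel M) u v -> word_cong (coxeter_rel M) u v.
Proof.
elim=> {u v} [u v a b r|u|u v _ h|u v w _ uv _ vw].
- exact/wc_rel/CoxBraid.
- exact: wc_refl.
- exact: wc_sym.
- exact: wc_trans vw.
Qed.

Section Exchange.
Variables (S : choiceType) (M : coxeter_matrix S).
Notation cw := (cox_word M).
Notation cgen := (cox_gen M).

(** The parity of the number of prefixes [v ++ [:: s]] of [u] such that
[v s v^-1] is [r]: geometrically, whether the gallery of chambers described by
[u] crosses the wall of the reflection [r] an odd number of times, that is,
whether this wall separates its ends. *)
Fixpoint parity (u : seq S) (r : coxeter_group M) : bool :=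
  if u is s :: u' then (cgen s == r) (+) parity u' (r ^ cgen s) else false.

Lemma parity_cat u v r : parity (u ++ v) r = parity u r (+) parity v (r ^ cw u).
Proof.
elim: u r => [|s u IH] r /=; first by rewrite cox_word_nil conjg1.
by rewrite IH cox_word_cons conjgM addbA.
Qed.

Lemma alt_reflJ s t i :
  ((cgen t * cgen s) ^+ i * cgen t) ^ cgen s =
  (cgen s * cgen t) ^+ i.+1 * cgen s.
Proof. by rewrite cgenJ -(mulgA _ (cgen t)) -expgSr expg_shift. Qed.

Lemma conj_cgen_eq s (x r : coxeter_group M) :
  (x == r ^ cgen s) = (x ^ cgen s == r).
Proof.
by rewrite -(inj_eq (@conjg_inj _ (cgen s)) x) -conjgM cgenK conjg1.
Qed.

Lemma parity_alt k s t r :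
  parity (alt k s t) r =
    \big[addb/false]_(i < k) ((cgen s * cgen t) ^+ i * cgen s == r).
Proof.
elim: k s t r => [|k IH] s t r; first by rewrite big_ord0.
rewrite big_ord_recl /= mul1g IH; congr (_ (+) _).
by apply: eq_bigr => i _; rewrite conj_cgen_eq alt_reflJ.
Qed.

Lemma alt_refl_invol k s t :
  ((cgen s * cgen t) ^+ k * cgen s)^-1 = (cgen s * cgen t) ^+ k * cgen s.
Proof.
rewrite invgM cgenV -expg_shift; congr (_ * _).
by rewrite -expVgn invgM !cgenV.
Qed.

(** The walls crossed by the two sides of a braid relation are the same, in the
opposite order. *)
Lemma alt_refl_rev m s t i : (cgen s * cgen t) ^+ m = 1 -> (i < m)%N ->
  (cgen s * cgen t) ^+ (m - i.+1) * cgen s = (cgen t * cgen s) ^+ i * cgen t.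
Proof.
case: m => // m; rewrite ltnS => st1 im.
rewrite -[RHS]alt_refl_invol; apply/esym/mulg1_eq.
rewrite -(expg_shift (cgen t)) -(mulgA (cgen t)) (mulgA (_ ^+ i)) -expgnDr.
rewrite subSS subnKC // mulgA expg_shift -mulgA -expgSr.
by apply: invg_inj; rewrite -expVgn invgM !cgenV st1 invg1.
Qed.

(** This is what makes [parity] useful: a wall separates the ends of a gallery
or not, whichever gallery joins them. *)
Lemma parity_cong u v :
  word_cong (coxeter_rel M) u v -> parity u =1 parity v.
Proof.
elim=> {u v} [u v a b r|//|u v _ E r|u v w _ E1 _ E2 r]; last 2 first.
- by rewrite E.
- by rewrite E1.
move=> x; have uv : cw u = cw v.
  by apply/cox_wordP; have := wc_rel [::] [::] r; rewrite !cats0.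
rewrite !parity_cat uv; congr (_ (+) (_ (+) _)).
case: r {uv} => [_ _ [s t m st Mst]|s] /=; last first.
  by rewrite conj_cgen_eq cgenJ cgenK mulg1 addbF addbb.
rewrite !parity_alt (reindex_inj rev_ord_inj) /=; apply: eq_bigr => i _.
rewrite alt_refl_rev //; apply/alt_eq_expg/cox_wordP.
have := wc_rel [::] [::] (CoxBraid (BraidRel st Mst)); by rewrite !cats0.
Qed.

(** Folding the gallery along a wall that it crosses removes the letter of the
crossing. *)
Lemma parity_delete u r : parity u r ->
  exists2 v, cw v = r * cw u & size u = (size v).+1.
Proof.
elim: u r => [//|s u IH] r /=; have [<- _|_ /=] := eqVneq.
  by exists u; rewrite // cox_word_cons cgenKl.
move=> /IH[v Ev ->]; exists (s :: v) => //.
by rewrite !cox_word_cons Ev conjgE cgenV !mulgA cgenK mul1g.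
Qed.

Definition reduced u := forall v, cw v = cw u -> (size u <= size v)%N.

Lemma reduced_exists u : exists2 v, reduced v & cw v = cw u.
Proof.
have ex : exists n, `[< exists2 v, cw v = cw u & size v = n >].
  by exists (size u); apply/asboolP; exists u.
case: (ex_minnP ex) => n /asboolP[v vu <-] minv; exists v => // w wv.
by apply: minv; apply/asboolP; exists w; rewrite ?wv.
Qed.

Lemma reduced_eq u v : reduced u -> cw v = cw u -> size v = size u -> reduced v.
Proof. by move=> ru vu sz w; rewrite vu sz => /ru. Qed.

Lemma reduced_catl u v : reduced (u ++ v) -> reduced u.
Proof.
move=> ruv w wu; have := ruv (w ++ v).
by rewrite !cox_word_cat wu !size_cat leq_add2r; apply.
Qed.

Lemma reduced_catr u v : reduced (u ++ v) -> reduced v.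
Proof.
move=> ruv w wv; have := ruv (u ++ w).
by rewrite !cox_word_cat wv !size_cat leq_add2l; apply.
Qed.

(** Suppose that the wall of [s] is not crossed by [u]. Then every word for
[s u] crosses it; deleting a letter of a shortest one gives a word for [u],
which has at least the length of [u]. So [s :: u] is reduced. *)
Lemma descent_parity s u : ~ reduced (s :: u) -> reduced u -> parity u (cgen s).
Proof.
move=> nr ru; apply: contrapT => /negP par; apply: nr.
have [v rv vsu] := reduced_exists (s :: u).
have := parity_cong ((cox_wordP _ _ _).1 vsu) (cgen s).
rewrite /= eqxx cgenJ cgenK mulg1 (negPf par) /= => /parity_delete[w wv sv].
have {}wv : cw w = cw u by rewrite wv vsu cox_word_cons cgenKl.
move=> x xsu; apply: (@leq_trans (size v)); last by apply: rv; rewrite vsu.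
by rewrite sv ltnS; exact: ru.
Qed.

Lemma parity_head s u : reduced (s :: u) -> parity (s :: u) (cgen s).
Proof.
move=> ru; apply: descent_parity => // rsu; have := rsu u.
by rewrite !cox_word_cons cgenKl => /(_ erefl); rewrite /= ltnNge leqnSn.
Qed.

(** * Reduced words are connected by braid relations *)

(** A wall met by [alt k s t] is that of [(st)^i s] for some [i < k]; if it is
that of [t], then [(st)^(i+1) = 1]. *)
Lemma parity_alt_order k s t : s <> t -> parity (alt k s t) (cgen t) ->
  exists2 m, M s t = Some m & (m <= k)%N.
Proof.
move=> st; rewrite parity_alt => par.
have [i Ei] : exists i : 'I_k, (cgen s * cgen t) ^+ i * cgen s == cgen t.
  apply: contrapT => ne; move: par; rewrite big1 // => i _.
  by apply/negP => Ei; apply: ne; exists i.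
have [|m Mst mi] := @cgen_mul_order _ M s t i.+1 st isT.
  by rewrite expgSr mulgA (eqP Ei) cgenK.
by exists m => //; exact: leq_trans (ltn_ord i).
Qed.

(** An element with the two descents [s] and [t] starts with longer and longer
alternating words, until the braid relation is reached: the crossing of the wall
of [s] cannot happen inside [alt k t s] when [k < m], hence the deleted letter
lies after this prefix. *)
Lemma dihedral_prefix k u s t : s <> t ->
    parity u (cgen s) -> parity u (cgen t) ->
  (exists2 m, M s t = Some m & (m < k)%N) \/
  (exists2 y, cw (alt k s t ++ y) = cw u & (k + size y = size u)%N).
Proof.
elim: k s t => [|k IH] s t st us ut; first by right; exists u.
have [[m Mts mk]|[y yu szy]] := IH t s (nesym st) ut us.
  by left; exists m; [rewrite cox_sym | exact: ltnW].
have := parity_cong ((cox_wordP _ _ _).1 yu) (cgen s).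
rewrite us parity_cat; case par: (parity (alt k t s) _) => /=.
  have [m Mts mk] := parity_alt_order (nesym st) par.
  by left; exists m; [rewrite cox_sym | exact: mk].
move=> /parity_delete[y' y'E szy']; right; exists y'; last first.
  by rewrite -szy szy' addnS.
rewrite cox_word_cons cox_word_cat y'E (mulgA (cw (alt k t s))) -conjgC -mulgA.
by rewrite cgenKl -cox_word_cat.
Qed.

(** By induction on the length. If the first letters [s] and [t] differ, both
are descents, and [dihedral_prefix] gives a word [alt m s t ++ y] of the same
element, where [m] is the entry of [s] and [t]. Each of the given words
shares its first letter with one of the words [alt m s t ++ y] and
[alt m t s ++ y], which a braid relation joins, and induction applies to the
remaining letters. *)
Theorem matsumoto u v : reduced u -> reduced v -> cw u = cw v ->
  word_cong (braid_rel M) u v.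
Proof.
have [n] := ubnP (size u); elim: n u v => // n IH [|s u] [|t v] szu ru rv uv.
- exact: wc_refl.
- by have := rv [::] uv.
- by have := ru [::] (esym uv).
have szuv : size (s :: u) = size (t :: v).
  by apply/eqP; rewrite eqn_leq; apply/andP; split; [exact: ru | exact: rv].
have ru' : reduced u by exact: (@reduced_catr [:: s]).
have rv' : reduced v by exact: (@reduced_catr [:: t]).
have consE w x y : word_cong (braid_rel M) x y ->
    word_cong (braid_rel M) (w :: x) (w :: y).
  exact: (word_cong_cat (wc_refl _ [:: w])).
have [st|/eqP st] := eqVneq s t.
  rewrite -st; apply: consE; apply: IH => //.
  by move: uv; rewrite -st !cox_word_cons => /mulgI.
have us := parity_head ru.
have ut : parity (s :: u) (cgen t).
  by rewrite (parity_cong ((cox_wordP _ _ _).1 uv)) parity_head.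
have [m Mst mu] : exists2 m, M s t = Some m & (m <= size (s :: u))%N.
  have [//|[y _ /eqP]] := dihedral_prefix (size (s :: u)).+1 st us ut.
  by rewrite eqn_leq addSn ltnNge leq_addr.
have [[m2]|[y yu szy]] := dihedral_prefix m st us ut.
  by rewrite Mst => -[<-]; rewrite ltnn.
have br : word_cong (braid_rel M) (alt m s t ++ y) (alt m t s ++ y).
  exact: (wc_rel [::] y (BraidRel st Mst)).
have yv : cw (alt m t s ++ y) = cw (t :: v).
  by rewrite -uv -yu; apply/cox_wordP/wc_sym/braid_cong_cox.
case: m Mst mu yu szy br yv => [|m] Mst mu yu szy br yv.
  by have := cox_ge2 st Mst.
have uy : word_cong (braid_rel M) u (alt m t s ++ y).
  have E : cw (alt m t s ++ y) = cw u.
    by move: yu; rewrite !cox_word_cons => /mulgI.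
  apply: IH => //; apply: (reduced_eq ru' E).
  by apply: succn_inj; rewrite size_cat size_alt -addSn.
have vy : word_cong (braid_rel M) v (alt m s t ++ y).
  have E : cw (alt m s t ++ y) = cw v.
    by move: yv; rewrite !cox_word_cons => /mulgI.
  apply: IH => //.
    by case: szuv => <-.
  apply: (reduced_eq rv' E).
  by apply: succn_inj; rewrite size_cat size_alt -addSn szy.
apply: (wc_trans (consE s _ _ uy)); apply: (wc_trans br).
exact/wc_sym/consE.
Qed.
End Exchange.

(** * Cancellation below the Garside element *)

Section Cancellation.
Variables (S : choiceType) (M : coxeter_matrix S).
Notation cw := (cox_word M).
Notation artin_word := (\pi_(artin_monoid M)).

Lemma artin_wordP u v :
  artin_word u = artin_word v <-> word_cong (braid_rel M) u v.
Proof. exact: presented_eqP. Qed.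

Lemma artin_word_cat u v : artin_word (u ++ v) = artin_word u * artin_word v.
Proof. exact: pi_catE. Qed.

Lemma artin_wordK (x : artin_monoid M) : artin_word (repr x) = x.
Proof. exact: reprK. Qed.

Lemma artin_lengthM (x y : artin_monoid M) :
  artin_length (x * y) = (artin_length x + artin_length y)%N.
Proof.
rewrite -[x]artin_wordK -[y]artin_wordK -artin_word_cat.
by rewrite !artin_lengthE size_cat.
Qed.

Lemma artin_length0 (x : artin_monoid M) : artin_length x = 0%N -> x = 1.
Proof. by move/size0nil => x0; rewrite -[x]artin_wordK x0. Qed.

Lemma artin_cox_word u v : artin_word u = artin_word v -> cw u = cw v.
Proof. by move/artin_wordP/braid_cong_cox/cox_wordP. Qed.

Lemma reduced_braid u v :
  reduced M u -> artin_word u = artin_word v -> reduced M v.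
Proof.
move=> ru uv; apply: (reduced_eq ru); first exact/esym/artin_cox_word.
by rewrite -(artin_lengthE M) -uv artin_lengthE.
Qed.

(** The suffixes of reduced words are reduced, so they can be compared in the
Coxeter group, where cancellation is free. *)
Lemma reduced_mulI u v v' : reduced M (u ++ v) ->
  artin_word (u ++ v) = artin_word (u ++ v') -> artin_word v = artin_word v'.
Proof.
move=> ruv E; apply/artin_wordP/matsumoto; first exact: reduced_catr ruv.
  exact: reduced_catr (reduced_braid ruv E).
by move: (artin_cox_word E); rewrite !cox_word_cat => /mulgI.
Qed.

(** Otherwise there would be reduced words of every length. *)
Lemma longest_word : spherical M ->
  exists2 u, reduced M u & forall s, ~ reduced M (s :: u).
Proof.
move=> /finite_seqP[e eE]; apply: contrapT => no_longest.
have long n : exists2 u, reduced M u & size u = n.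
  elim: n => [|n [u ru <-]]; first by exists [::].
  apply: contrapT => no_long; apply: no_longest; exists u => // s rsu.
  by apply: no_long; exists (s :: u).
have [u ru su] := long (\max_(x <- e) size (repr x)).+1.
have : (size (repr (cw u)) <= \max_(x <- e) size (repr x))%N.
  apply: (@leq_bigmax_seq _ _ xpredT
    (fun x : coxeter_group M => size (repr x))) => //.
  by have : setT (cw u) by []; rewrite eE.
by rewrite leqNgt -su => /negP; apply; apply: ru; exact: reprK.
Qed.

(** Every letter [s] is a descent of a longest word [u]: some word [s :: v] of
the same length has the same value, and is equal to [u] in the monoid by
[matsumoto]. So [u] is a common multiple of the generators. *)
Lemma garside_reduced (D : artin_monoid M) :
  spherical M -> is_garside D -> reduced M (repr D).
Proof.
move=> /longest_word[u ru u_max] [_ D_min].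
have [s|r uE] := D_min (artin_word u).
  have [v vE uv] := parity_delete (descent_parity (u_max s) ru).
  have E : cw u = cw (s :: v) by rewrite cox_word_cons vE cgenKl.
  have rv : reduced M (s :: v) by exact: (reduced_eq ru).
  exists (artin_word v); rewrite -(artin_word_cat [:: s]).
  exact/artin_wordP/matsumoto.
apply: (@reduced_catl _ _ _ (repr r)); apply: reduced_braid ru _.
by rewrite artin_word_cat !artin_wordK.
Qed.

Lemma garside_mulI (x y z : artin_monoid M) :
  spherical M -> is_garside (x * y) -> x * y = x * z -> y = z.
Proof.
move=> sph gar E; rewrite -[y]artin_wordK -[z]artin_wordK.
apply: (@reduced_mulI (repr x)); last by rewrite !artin_word_cat !artin_wordK.
apply: reduced_braid (garside_reduced sph gar) _.
by rewrite artin_word_cat !artin_wordK.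
Qed.

Lemma mul_agen_inj (x : artin_monoid M) : injective (fun s => x * agen M s).
Proof.
move=> s t /=; rewrite -[x]artin_wordK -!artin_word_cat => /artin_cox_word.
by rewrite !cox_word_cat => /mulgI; exact: cgen_inj.
Qed.

Lemma word_conj_push (T : Type) (f g : T -> S) (x : artin_monoid M) w :
  (forall i, agen M (f i) * x = x * agen M (g i)) ->
  artin_word (map f w) * x = x * artin_word (map g w).
Proof.
move=> fg; elim: w => [|i w IH] /=; first by rewrite mul1g mulg1.
rewrite -cat1s artin_word_cat -mulgA IH mulgA fg -mulgA -artin_word_cat.
by rewrite cat1s.
Qed.
End Cancellation.

(** * The relative Garside element *)

Theorem proposition4 (p : nat) (p_gt0 : (1 <= p)%N)
    (M' : coxeter_matrix 'I_p) (M : coxeter_matrix 'I_p.+1)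
    (sub : full_subgraph (@old_vertex p) M' M)
    (sphM' : spherical M') (sphM : spherical M)
    (D' : artin_monoid M') (garD' : is_garside D')
    (D : artin_monoid M) (garD : is_garside D)
    (R : artin_monoid M) (defR : (D = artin_incl sub D' * R)%g)
    (sigma_n : 'S_p.+1)
    (sigma_nE : forall i : 'I_p.+1,
      (agen M i * D = D * agen M (sigma_n i))%g)
    (sigma : 'I_p -> 'I_p.+1)
    (sigma_bij : set_bij [set: 'I_p]%classic [set~ sigma_n ord_max]%classic
                   sigma)
    (sigmaE : forall i : 'I_p,
      (agen M (old_vertex i) * R = R * agen M (sigma i))%g)
    (U : artin_monoid M)
    (U_a : ldvd (agen M ord_max) U)
    (k : 'I_p.+1) (tau : 'I_p -> 'I_p.+1)
    (tau_bij : set_bij [set: 'I_p]%classic [set~ k]%classic tau)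
    (U_b : forall i : 'I_p,
      (agen M (old_vertex i) * U = U * agen M (tau i))%g)
    (U_c : artin_length U = (artin_length D - artin_length D')%N) :
  U = R /\ k = sigma_n ord_max /\ tau = sigma.
Proof.
set E' := artin_incl sub D'.
have E'U : E' * U = U * \pi_(artin_monoid M) (map tau (repr D')).
  exact: word_conj_push U_b.
have gen_dvd s : ldvd (agen M s) (E' * U).
  (* [lift ord_max] enumerates the old generators. *)
  case: (unliftP ord_max s) => [i|] ->; last first.
    have [r Ur] := U_a; rewrite E'U {1}Ur -mulgA; exact: (ex_intro _ _ erefl).
  have -> : lift ord_max i = old_vertex i.
    by apply: val_inj; rewrite /= /bump leqNgt ltn_ord.
  have [r D'r] := garD'.1 i; rewrite /E' D'r artin_inclM artin_incl_gen -mulgA.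
  exact: (ex_intro _ _ erefl).
have [r E'UD] := garD.2 _ gen_dvd.
have lenD : artin_length D = (artin_length D' + artin_length R)%N.
  rewrite defR artin_lengthM; congr (_ + _)%N.
  by rewrite artin_lengthE size_map.
have r1 : r = 1.
  apply: artin_length0; apply/eqP.
  rewrite -(eqn_add2l (artin_length D)) -artin_lengthM -E'UD artin_lengthM U_c.
  rewrite artin_lengthE size_map -/(artin_length D') addn0 subnKC // lenD.
  exact: leq_addr.
have UR : U = R.
  apply: (@garside_mulI _ _ E') => //; first by rewrite E'UD r1 mulg1.
  by rewrite E'UD r1 mulg1.
have tausigma : tau = sigma.
  by apply/funext => i; apply: (@mul_agen_inj _ _ U); rewrite -U_b UR sigmaE.
split=> //; split=> //; apply: contrapT => k_m.
have [tau_k _ _] := tau_bij; have [_ _ /(_ k k_m)[i _ sik]] := sigma_bij.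
by apply: (tau_k i) => //=; rewrite tausigma.
Qed.
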